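(* For any connected graph $G$ with $n\geq 3$ vertices, $tr(G)=2n-2$ if and only if $G$ is a tree with $2$ or $3$ leaves.
   Context: All graphs are finite, simple and undirected. $d(u,v)$ denotes the usual shortest-path distance. The triameter of a connected graph $G=(V,E)$ on at least $3$ vertices is $tr(G)=\max\{d(u,v)+d(v,w)+d(u,w): u,v,w\in V\}$. A leaf is a vertex of degree $1$. *)

(* Defs.v *)
From mathcomp Require Import all_boot.

Set Implicit Arguments.
Unset Strict Implicit.
Unset Printing Implicit Defensive.

(* A finite simple graph is a symmetric irreflexive relation e on a finType. *)

Section Graph.

Variables (T : finType) (e : rel T).

Definition connected_graph : Prop := forall x y : T, connect e x y.

Definition degree (x : T) : nat := #|[set y | e x y]|.

Definition leaves : {set T} := [set x | degree x == 1].

Definition acyclic : Prop :=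
  forall c : seq T, 2 < size c -> ~ ucycle e c.

Definition is_tree : Prop := connected_graph /\ acyclic.

Definition has_walk (k : nat) (x y : T) : bool :=
  [exists p : k.-tuple T, path e x p && (last x p == y)].

(* The search can stop before #|T|: if y is reachable from x, then a shortest
   walk has no repeated vertex.  If y is unreachable, dist x y is the junk
   value #|T|. *)
Definition dist (x y : T) : nat :=
  find (fun k => has_walk k x y) (iota 0 #|T|).

Definition triameter : nat :=
  \max_(u : T) \max_(v : T) \max_(w : T) (dist u v + dist v w + dist u w).

Lemma has_walkP k x y :
  reflect (exists p : seq T, [/\ size p = k, path e x p & last x p = y])
          (has_walk k x y).
Proof.
apply: (iffP existsP) => [[p /andP[ep /eqP lp]]|[p [sp ep lp]]].
  by exists p; rewrite size_tuple.
have sp' : size p == k by apply/eqP.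
by exists (Tuple sp'); rewrite /= ep lp eqxx.
Qed.

Lemma dist_min x y (p : seq T) :
  path e x p -> last x p = y -> dist x y <= size p.
Proof.
move=> ep lp; have w : has_walk (size p) x y by apply/has_walkP; exists p.
have [le|lt] := leqP #|T| (size p).
  by apply: leq_trans le; rewrite -[leqRHS](size_iota 0) find_size.
rewrite leqNgt; apply/negP => /(before_find 0).
by rewrite nth_iota // add0n w.
Qed.

Lemma dist_walk x y : connect e x y ->
  exists p : seq T, [/\ path e x p, last x p = y & size p = dist x y].
Proof.
move=> /connectP[p0 ep0 ->]; case/shortenP: ep0 => p ep up _.
have lt : size p < #|T|.
  by rewrite -[(size p).+1]/(size (x :: p)) -(card_uniqP up) max_card.
have hs : has (fun k => has_walk k x (last x p)) (iota 0 #|T|).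
  apply/hasP; exists (size p); first by rewrite mem_iota.
  by apply/has_walkP; exists p.
have /has_walkP[q [sq eq lq]] := nth_find 0 hs.
exists q; split=> //; rewrite sq nth_iota ?add0n //.
by rewrite -[X in _ < X](size_iota 0) -has_find.
Qed.

End Graph.

(* Main.v *)
Require Import Defs.
From mathcomp Require Import all_boot.
From mathcomp Require Import zify.

(** Write [perimeter u v w] for the sum of the three pairwise distances, so
    that the triameter is the largest perimeter.  Let [n] be the number of
    vertices.

    Upper bound.  Let [P] be a geodesic from [u] to [v], let [m] be a vertex of
    [P] nearest to [w], and let [Q] be a geodesic from [m] to [w].  By the
    choice of [m], [Q] meets [P] only in [m], so this tripod has
    [d u v + d m w + 1 <= n] vertices ([tripod]); the triangle inequality
    through [m] bounds the perimeter by twice [d u v + d m w], hence by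
    [2n - 2] ([perimeter_le]).

    Equality forces a tree.  If the perimeter is [2n - 2], then the tripod
    contains every vertex and [m] lies on geodesics between all three pairs.
    An edge that is not a step of [P] or [Q] would be a shortcut for one of the
    pairs, so every vertex has at most one neighbour that is not farther from
    [u].  A cycle would violate this at its vertex farthest from [u].  Every
    vertex other than [u], [v], [w] is interior to a geodesic and so is not a
    leaf ([max_perimeter_structure]).

    Trees with few leaves reach the bound.  In a tree whose leaves are among
    [u], [v], [w], a walk that leaves any of these three and keeps going away
    from it past a given vertex ends at another of the three ([leaf_beyond]).
    So each vertex lies in at least two of the three intervals, and an interval
    [interval a b] of a tree has at most [d a b + 1] vertices
    ([card_interval]).  Double counting gives a perimeter of at least [2n - 3];
    trees are bipartite, so the perimeter is even ([perimeter_even]) and is at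
    least [2n - 2] ([perimeter_ge]). *)

Set Implicit Arguments.
Unset Strict Implicit.
Unset Printing Implicit Defensive.

(** * Distances and intervals *)

Section ConnectedGraph.

Variables (T : finType) (e : rel T).
Hypothesis e_sym : symmetric e.
Hypothesis e_irr : irreflexive e.
Hypothesis e_conn : connected_graph e.

Local Notation d := (dist e).

Lemma dist_refl x : d x x = 0.
Proof. by apply/eqP; rewrite -leqn0; apply: (@dist_min _ e x x [::]). Qed.

Lemma dist_eq0 x y : d x y = 0 -> x = y.
Proof.
by have [p [_ <- <-]] := dist_walk (e_conn x y); case: p.
Qed.

Lemma dist_triangle y x z : d x z <= d x y + d y z.
Proof.
have [p [ep lp <-]] := dist_walk (e_conn x y).
have [q [eq lq <-]] := dist_walk (e_conn y z).
by rewrite -size_cat dist_min ?cat_path ?last_cat ?ep ?lp.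
Qed.

Lemma dist_le_sym x y : d x y <= d y x.
Proof.
have [p [ep <- <-]] := dist_walk (e_conn y x).
rewrite -[size p](size_belast y) -size_rev dist_min //.
  by rewrite rev_path (eq_path (e' := e)).
by case: p {ep} => //= z p; rewrite rev_cons last_rcons.
Qed.

Lemma dist_sym x y : d x y = d y x.
Proof. by apply/eqP; rewrite eqn_leq !dist_le_sym. Qed.

Lemma dist_edge x y : e x y -> d x y <= 1.
Proof.
by move=> exy; apply: (@dist_min _ e x y [:: y]) => //=; rewrite exy.
Qed.

Lemma dist_edge_le r x y : e x y -> d r y <= (d r x).+1.
Proof.
by move=> /dist_edge exy; have := dist_triangle x r y; lia.
Qed.

Lemma closer_neighbour r x : x != r -> exists2 y, e x y & d r x = (d r y).+1.
Proof.
move=> /eqP xr; have [[|y p] [/= ep lp sp]] := dist_walk (e_conn x r).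
  by case: xr.
have /andP[exy ep'] := ep; exists y => //.
have := dist_min ep' lp; rewrite -(dist_sym x) -(dist_sym y) -sp.
have := dist_triangle y x r; have := dist_edge exy; lia.
Qed.

(** The vertices that lie on some geodesic between [a] and [b]. *)
Definition interval a b : {set T} := [set z | d a z + d z b == d a b].

Lemma in_interval a b z : (z \in interval a b) = (d a z + d z b == d a b).
Proof. by rewrite inE. Qed.

Lemma intervalC a b : interval a b = interval b a.
Proof.
by apply/setP => z; rewrite !in_interval addnC !(dist_sym z) (dist_sym a b).
Qed.

(** The next vertices of a geodesic through [z], towards [a] and towards [b],
    differ: a common one would give a walk from [a] to [b] shorter by two. *)
Lemma interval_notin_leaves a b z :
  z \in interval a b -> z != a -> z != b -> z \notin leaves e.
Proof.
rewrite in_interval => /eqP zab za zb.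
have [y ezy ya] := closer_neighbour za.
have [y' ezy' yb] := closer_neighbour zb.
rewrite inE; apply/negP => /cards1P[t Nz].
have : y \in [set t] by rewrite -Nz inE.
have : y' \in [set t] by rewrite -Nz inE.
move=> /set1P y't /set1P yt; subst.
have := dist_triangle t a b; move: zab ya yb.
by rewrite (dist_sym z b) (dist_sym t b); lia.
Qed.

(** A geodesic enters the proof only through its vertex set, one vertex for
    each distance from [a], so it is built as a set and not as a path. *)
Lemma geodesic a b : exists P : {set T},
  [/\ a \in P, b \in P, P \subset interval a b,
      {in P &, injective (d a)} & #|P| = (d a b).+1].
Proof.
have [k] := ubnP (d a b); elim: k b => // k IH b lek.
have [->|ba] := eqVneq b a.
  exists [set a]; rewrite set11 cards1 dist_refl; split=> //.
    by rewrite sub1set in_interval !dist_refl.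
  by move=> x y /set1P-> /set1P->.
have [c ebc dab] := closer_neighbour ba.
have [|P [aP cP /subsetP PI injP cardP]] := IH c; first by lia.
have lt z : z \in P -> d a z < d a b.
  by move=> /PI; rewrite in_interval => /eqP; lia.
have bP : b \notin P by apply/negP => /lt; rewrite ltnn.
exists (b |: P); rewrite !inE eqxx aP orbT cardsU1 bP cardP dab; split=> //.
  rewrite subUset sub1set in_interval dist_refl addn0 eqxx.
  apply/subsetP=> z /PI; rewrite !in_interval => /eqP zac.
  have := dist_triangle z a b; have := dist_triangle c z b.
  by have := dist_edge ebc; rewrite (dist_sym b c); lia.
move=> x y /setU1P[->|xP] /setU1P[->|yP] //; last by exact: injP.
- by move=> E; have := lt _ yP; rewrite -E ltnn.
- by move=> E; have := lt _ xP; rewrite -E ltnn.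
Qed.

(** * The upper bound *)

(** A vertex of [Q] other than [m] is strictly nearer to [w] than [m] is, so it
    cannot be on [P] when [m] is the vertex of [P] nearest to [w]. *)
Lemma tripod u v w : exists (m : T) (P Q : {set T}),
  [/\ [/\ m \in P, m \in Q & forall z, z \in P -> z \in Q -> z = m],
      P \subset interval u v /\ {in P &, injective (d u)},
      Q \subset interval m w /\ {in Q &, injective (d m)} &
      #|P :|: Q| = (d u v + d m w).+1].
Proof.
have [P [uP vP PI injP cardP]] := geodesic u v.
case: (arg_minnP (d^~ w) uP) => m mP mmin.
have [Q [mQ wQ QI injQ cardQ]] := geodesic m w.
have PQ z : z \in P -> z \in Q -> z = m.
  move=> /mmin le_mz /(subsetP QI); rewrite in_interval => /eqP zm.
  by apply: dist_eq0; rewrite dist_sym; lia.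
exists m, P, Q; split=> //; rewrite cardsU cardP cardQ.
suff ->: P :&: Q = [set m] by rewrite cards1; lia.
by apply/setP=> z; rewrite !inE; apply/andP/eqP => [[]|->] //; apply: PQ.
Qed.

Definition perimeter u v w := d u v + d v w + d u w.

Lemma perimeter_le u v w : perimeter u v w <= 2 * #|T| - 2.
Proof.
have [m [P [Q [[mP _ _] [/subsetP PI _] _ cardPQ]]]] := tripod u v w.
have := PI _ mP; rewrite in_interval /perimeter => /eqP muv.
have := max_card [in P :|: Q]; rewrite cardPQ.
have := dist_triangle m u w; have := dist_triangle m v w.
by rewrite (dist_sym v m); lia.
Qed.

(** * Acyclicity and depth functions *)

(** Edges join each vertex to at most one vertex of no greater depth [h]; with
    [h] the distance to a root, this is the parent function of a rooted tree. *)
Definition unique_parent (h : T -> nat) := forall x y y',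
  e x y -> e x y' -> h y <= h x -> h y' <= h x -> y = y'.

(** A deepest vertex of a cycle has two distinct neighbours on the cycle,
    neither of them deeper. *)
Lemma unique_parent_acyclic h : unique_parent h -> acyclic e.
Proof.
move=> uph [//|x0 c0] sc /andP[]; set c := x0 :: c0 in sc * => cc uc.
have [x xc xmax] : exists2 x, x \in c & forall y, y \in c -> h y <= h x.
  by case: (arg_maxnP (P := [in c]) h (mem_head x0 c0)) => x; exists x.
have [i s rs] := rot_to xc.
have mem_s y : y \in x :: s -> h y <= h x by rewrite -rs mem_rot => /xmax.
move: cc uc sc; rewrite -(rot_cycle i) -(rot_uniq i) -(size_rot i) rs.
case: s {rs} mem_s => [|y [|z s]] //= mem_s.
rewrite rcons_path => /andP[exy /andP[_ /andP[_ elx]]] /and3P[_ ys _] _.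
have lzs := mem_last z s.
have E : y = last z s.
  apply: (uph x) => //; first by rewrite e_sym.
    by apply: mem_s; rewrite !inE eqxx orbT.
  by apply: mem_s; rewrite in_cons in_cons lzs !orbT.
by rewrite E lzs in ys.
Qed.

(** Geodesics to [r] from two neighbours of [x] that are not farther from [r]
    avoid [x].  They connect these neighbours in the graph without [x], and [x]
    closes a path between them into a cycle. *)
Lemma acyclic_unique_parent r : acyclic e -> unique_parent (d r).
Proof.
move=> acy x y y' exy exy' ley ley'; apply/eqP/negPn/negP => yy'.
(* the graph without [x] *)
pose f := [rel a b | [&& e a b, a != x & b != x]].
have f_sym : symmetric f by move=> a b /=; rewrite e_sym (andbC (a != x)).
have to_root z : z != x -> d r z <= d r x -> connect f z r.
  have [k] := ubnP (d r z); elim: k z => // k IH z lek zx lez.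
  have [->//|zr] := eqVneq z r.
  have [t ezt dt] := closer_neighbour zr.
  have tx : t != x by apply: contraTneq lez => <-; rewrite dt ltnn.
  apply: (connect_trans (y := t)); last by apply: IH => //; lia.
  by apply: connect1; rewrite /= ezt zx.
have yx z : e x z -> z != x by apply: contraTneq => ->; rewrite e_irr.
have : connect f y y'.
  apply: (connect_trans (y := r)); first by apply: to_root; rewrite ?yx.
  by rewrite (sym_connect_sym f_sym) to_root ?yx.
case/connectP=> p0 fp0; case/shortenP: fp0 => p fp up _ y'E.
have px : x \notin p.
  elim: p y fp {up y'E yy' exy ley} => //= z p IH y /andP[/and3P[_ _ zx]].
  by move=> /IH xp; rewrite inE eq_sym (negPf zx).
apply: (acy (x :: y :: p)).
  by case: p y'E {fp up px} => //= E; rewrite E eqxx in yy'.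
rewrite /ucycle /= rcons_path exy -y'E (e_sym y') exy' andbT inE negb_or px.
rewrite eq_sym yx // (sub_path _ fp) //=.
by move=> a b /and3P[].
Qed.

(** * Trees *)

Section Tree.

Hypothesis e_acyclic : acyclic e.

(** The ends of an edge are never at the same distance from [r]: otherwise one
    end, which is not [r], would have both the other end and its own parent as
    neighbours that are not farther from [r]. *)
Lemma edge_parity r x y : e x y -> odd (d r y) = ~~ odd (d r x).
Proof.
move=> exy; have eyx : e y x by rewrite e_sym.
have := dist_edge_le r exy; have := dist_edge_le r eyx.
have [E|] := eqVneq (d r x) (d r y); last by lia.
have [xr|xr] := eqVneq x r.
  move: E; rewrite xr dist_refl => /esym/dist_eq0 ry.
  by move: exy; rewrite xr -ry e_irr.
have [z exz dz] := closer_neighbour xr.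
have zy : z = y.
  by apply: (acyclic_unique_parent (r := r) e_acyclic exz exy); lia.
by move: dz; rewrite zy; lia.
Qed.

(** The parity of the distance to [u] is a proper 2-colouring, so [d x y] is
    even exactly when [x] and [y] have the same colour. *)
Lemma perimeter_even u v w : ~~ odd (perimeter u v w).
Proof.
suff H x y : odd (d x y) = odd (d u x) (+) odd (d u y).
  rewrite /perimeter !oddD (H v w).
  by case: (odd _) => /=; case: (odd _).
have [p [ep <- <-]] := dist_walk (e_conn x y).
elim: p x ep => [|z p IH] x /=; first by rewrite addbb.
move=> /andP[exz /IH ->]; rewrite (edge_parity u exz).
by case: (odd (d u x)); case: (odd _).
Qed.

(** Two vertices of an interval on the same level have successors towards [b],
    which coincide by induction; the two vertices are then parents of this
    common successor for the root [a]. *)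
Lemma interval_level_inj a b : {in interval a b &, injective (d a)}.
Proof.
move=> x y; have [k] := ubnP (d b x); elim: k x y => // k IH x y lek.
move=> xI yI dxy; move: (xI) (yI); rewrite !in_interval.
rewrite (dist_sym x) (dist_sym y) => /eqP dx /eqP dy.
have [xb|xb] := eqVneq x b.
  by subst x; apply: dist_eq0; move: dx dy; rewrite dist_refl; lia.
have yb : y != b.
  apply: contra xb => /eqP yb; subst y; apply/eqP/esym/dist_eq0.
  by move: dx dy; rewrite dist_refl; lia.
have up z : d a z + d b z = d a b -> z != b -> exists t,
    [/\ e t z, d b t < d b z, d a t = (d a z).+1 & t \in interval a b].
  move=> dz zb; have [t ezt dt] := closer_neighbour zb.
  have := dist_triangle t a b; have := dist_edge_le a ezt.
  rewrite (dist_sym t b) => *.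
  exists t; rewrite in_interval (dist_sym t b) e_sym.
  by split=> //; lia.
have [x' [ex lx dx' x'I]] := up x dx xb.
have [y' [ey ly dy' y'I]] := up y dy yb.
have E : x' = y' by apply: IH => //; lia.
subst y'; apply: (acyclic_unique_parent (r := a) e_acyclic ex ey); lia.
Qed.

Lemma card_interval a b : #|interval a b| <= (d a b).+1.
Proof.
pose f z : 'I_(d a b).+1 := inord (d a z).
have fE z : z \in interval a b -> d a z = f z.
  by rewrite in_interval => /eqP z_ab; rewrite inordK //; lia.
rewrite -[leqRHS]card_ord.
rewrite -(card_in_imset (f := f)) ?max_card // => x y xI yI fxy.
by apply: (interval_level_inj xI yI); rewrite (fE _ xI) (fE _ yI) fxy.
Qed.

(** Extend a geodesic from [u] through [x] as far as possible: the far end has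
    only neighbours that are not farther from [u], hence a single one. *)
Lemma leaf_beyond u x : 1 < #|T| ->
  exists l, [/\ l \in leaves e, l != u & x \in interval u l].
Proof.
move=> T_gt1.
have xx : x \in interval u x by rewrite in_interval dist_refl addn0.
case: (arg_maxnP (P := [pred l | x \in interval u l]) (d u) xx) => l /= xl lmax.
have lu : l != u.
  apply: contraTneq T_gt1 => lu; rewrite -leqNgt.
  move: xl; rewrite lu in_interval dist_refl addn_eq0.
  move=> /andP[/eqP/dist_eq0 ux _].
  rewrite -[#|T|]cardsT -(cards1 u); apply/subset_leq_card/subsetP=> y _.
  rewrite inE; apply/eqP/esym/dist_eq0/eqP; rewrite -leqn0.
  rewrite -(dist_refl u) -{3}lu; apply: lmax.
  by rewrite -ux in_interval dist_refl.
exists l; split=> //.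
have low y : e l y -> d u y <= d u l.
  move=> ely; rewrite leqNgt; apply/negP => lt.
  have xy : x \in interval u y.
    move: xl; rewrite !in_interval => /eqP xl.
    have := dist_triangle x u y; have := dist_edge_le x ely.
    have := dist_edge_le u ely; lia.
  by have := lmax _ xy; rewrite leqNgt lt.
have [y ely _] := closer_neighbour lu.
rewrite inE; apply/cards1P; exists y; apply/setP=> z; rewrite !inE.
apply/idP/eqP => [elz|-> //].
exact: (acyclic_unique_parent e_acyclic elz ely (low _ elz) (low _ ely)).
Qed.

Lemma leaves_ge2 : 1 < #|T| -> 1 < #|leaves e|.
Proof.
move=> T_gt1; have /card_gt0P[u _] : 0 < #|T| by apply: ltnW.
have [l [lL _ _]] := leaf_beyond u u T_gt1.
have [l' [l'L l'l _]] := leaf_beyond l u T_gt1.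
by apply/card_gt1P; exists l, l'; rewrite eq_sym.
Qed.

(** Each vertex lies in two of the three intervals, so their sizes sum to at
    least [2 * #|T|].  As each size is at most one more than a distance, the
    perimeter is at least [2 * #|T| - 3], and parity gains the last unit. *)
Lemma perimeter_ge u v w : 1 < #|T| -> leaves e \subset [set u; v; w] ->
  2 * #|T| - 2 <= perimeter u v w.
Proof.
move=> T_gt1 sL.
(* The leaf beyond [x] as seen from [r] is [a] or [b]. *)
have from r a b x : leaves e \subset [set r; a; b] ->
    (x \in interval r a) || (x \in interval r b).
  have [l [lL lr xl]] := leaf_beyond r x T_gt1.
  move=> /subsetP/(_ l lL); rewrite -setUA in_setU1 (negPf lr) in_set2 /=.
  by case/orP => /eqP <-; rewrite xl ?orbT.
have cover x : 2 <= (x \in interval u v) + (x \in interval v w)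
                    + (x \in interval u w).
  have := from u v w x sL; have := from v u w x; have := from w u v x.
  rewrite (intervalC w) (intervalC v u) (intervalC w) => fw fv.
  have /fw : leaves e \subset [set w; u; v] by rewrite setUC setUA in sL *.
  have /fv : leaves e \subset [set v; u; w] by rewrite (setUC [set v]).
  by do 3 (case: (x \in interval _ _)).
have sumI a b : \sum_x (x \in interval a b : nat) = #|interval a b|.
  by rewrite -sum1_card [RHS]big_mkcond; apply: eq_bigr => x _; case: (_ \in _).
have : 2 * #|T| <= #|interval u v| + #|interval v w| + #|interval u w|.
  rewrite -!sumI -!big_split /= mulnC -sum_nat_const.
  exact: leq_sum.
have := card_interval u v; have := card_interval v w.
have := card_interval u w; have := perimeter_even u v w.
rewrite /perimeter; lia.
Qed.

End Tree.

(** * Triples of maximal perimeter *)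

(** Equality in the upper bound makes the tripod cover the graph.  No edge
    joins [P] to [Q] except inside one of them: otherwise it would shorten the
    distance between two of [u], [v], [w].  Hence the distance to [u] is a
    depth function with unique parents. *)
Lemma max_perimeter_structure u v w : perimeter u v w = 2 * #|T| - 2 ->
  acyclic e /\ leaves e \subset [set u; v; w].
Proof.
rewrite /perimeter => S_eq.
have [m [P [Q [[mP mQ PQ] [/subsetP PI injP] [/subsetP QI injQ] cardPQ]]]] :=
  tripod u v w.
have := PI _ mP; rewrite in_interval => /eqP muv.
have [cover duw dvw] : [/\ P :|: Q = setT, d u w = d u m + d m w &
                           d v w = d v m + d m w].
  have := max_card [in P :|: Q].
  have := dist_triangle m u w; have := dist_triangle m v w.
  rewrite (dist_sym v m) cardPQ => le1 le2 le3; split; try lia.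
  by apply/eqP; rewrite eqEcard subsetT cardsT cardPQ; lia.
have inPQ x : x \in P \/ x \in Q.
  by apply/orP; rewrite -in_setU cover inE.
have Pdist x : x \in P -> d u x + d v x = d u v.
  by move=> /PI; rewrite in_interval (dist_sym v) => /eqP.
have Qdist x : x \in Q -> d u x = d u m + d m x /\ d u x + d w x = d u w.
  move=> /QI; rewrite in_interval => /eqP; rewrite (dist_sym w).
  have := dist_triangle m u x; have := dist_triangle x u w; lia.
have injQu : {in Q &, injective (d u)}.
  by move=> x y xQ yQ E; apply: injQ => //;
     have := Qdist _ xQ; have := Qdist _ yQ; lia.
have Qm x : x \in Q -> d u x <= d u m -> x = m.
  by move=> xQ le; apply: injQu => //; have := Qdist _ xQ; lia.
(* An edge from [P] to [Q] yields a walk from [v] to [w]; its length is at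
   least [d v w], which goes through [m]. *)
have cross x y : x \in P -> y \in Q -> e x y -> d u x + d u y <= (d u m).*2.+1.
  move=> /Pdist xP /Qdist[yQ1 yQ2] exy.
  have := dist_triangle x v w; have := dist_triangle y x w.
  have := dist_edge exy; have := Pdist _ mP.
  rewrite (dist_sym y w); lia.
have parent x y : e x y -> d u y <= d u x ->
    d u x = (d u y).+1 /\ (x \in P /\ y \in P \/ x \in Q /\ y \in Q).
  move=> exy le; have eyx : e y x by rewrite e_sym.
  have ne : x <> y by move=> E; rewrite E e_irr in exy.
  have ltP : x \in P /\ y \in P \/ x \in Q /\ y \in Q.
    have [xP|xQ] := inPQ x; have [yP|yQ] := inPQ y; try by tauto.
      have := cross _ _ xP yQ exy => le'.
      by left; rewrite (Qm y) //; lia.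
    have := cross _ _ yP xQ eyx => le'.
    have [lex|ltx] := leqP (d u x) (d u m).
      by left; rewrite (Qm x).
    have := dist_edge_le u eyx => le''.
    right; split=> //; rewrite (injP y m) //; lia.
  split=> //; suff : d u x <> d u y by have := dist_edge_le u eyx; lia.
  case: ltP => -[x_in y_in] E; apply: ne; [exact: injP|exact: injQu].
split.
  apply: (@unique_parent_acyclic (d u)) => x y y' exy exy' le le'.
  have [dy [[xP yP]|[xQ yQ]]] := parent x y exy le;
  have [dy' [[xP' yP']|[xQ' yQ']]] := parent x y' exy' le'.
  - by apply: injP => //; lia.
  (* In the mixed cases [x] is on both geodesics, so [x = m]; but no vertex of
     [Q] is nearer to [u] than [m]. *)
  - have := Qdist _ yQ'; rewrite -(PQ x) //; lia.
  - have := Qdist _ yQ; rewrite -(PQ x) //; lia.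
  - by apply: injQu => //; lia.
apply/subsetP=> x; apply: contraLR.
rewrite in_setU in_set1 in_set2 !negb_or -andbA.
move=> /and3P[xu xv xw].
have [/PI xI|xQ] := inPQ x; first exact: interval_notin_leaves xI xu xv.
apply: (@interval_notin_leaves u w) => //; rewrite in_interval (dist_sym x).
by have [_ ->] := Qdist _ xQ.
Qed.

(** * The triameter *)

Lemma triameter_le : triameter e <= 2 * #|T| - 2.
Proof.
by do 3 (apply/bigmax_leqP => ? _); apply: perimeter_le.
Qed.

Lemma perimeter_le_triameter u v w : perimeter u v w <= triameter e.
Proof.
rewrite /triameter.
apply: leq_trans (leq_bigmax u); apply: leq_trans (leq_bigmax v).
exact: (leq_bigmax (F := perimeter u v) w).
Qed.

Lemma triameter_attained : 0 < #|T| ->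
  exists u v w, triameter e = perimeter u v w.
Proof.
move=> T_gt0; rewrite /triameter.
have [u ->] := eq_bigmax (fun u => \max_v \max_w perimeter u v w) T_gt0.
have [v ->] := eq_bigmax (fun v => \max_w perimeter u v w) T_gt0.
have [w ->] := eq_bigmax (fun w => perimeter u v w) T_gt0.
by exists u, v, w.
Qed.

End ConnectedGraph.

Lemma card_le3_sub (T : finType) (A : {set T}) : #|A| = 2 \/ #|A| = 3 ->
  exists u v w, A \subset [set u; v; w].
Proof.
case=> cA.
  have /cards2P[u [v [_ ->]]] : #|A| == 2 by apply/eqP.
  by exists u, v, v; apply: subsetUl.
have /card_gt0P[u uA] : 0 < #|A| by rewrite cA.
move: cA; rewrite (cardsD1 u) uA => -[/eqP/cards2P[v [w [_ E]]]].
by exists u, v, w; rewrite -(setD1K uA) E setUA.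
Qed.

Theorem theorem3p3 (T : finType) (e : rel T)
    (e_sym : symmetric e) (e_irr : irreflexive e)
    (e_conn : connected_graph e) (T_ge3 : 3 <= #|T|) :
  triameter e = 2 * #|T| - 2 <->
  is_tree e /\ (#|leaves e| = 2 \/ #|leaves e| = 3).
Proof.
have T_gt1 : 1 < #|T| by apply: ltnW.
split=> [tr_eq|[[_ acy] cardL]].
  have [u [v [w tr_uvw]]] := triameter_attained e (ltnW T_gt1).
  have [acy sub] : acyclic e /\ leaves e \subset [set u; v; w].
    by apply: max_perimeter_structure; rewrite // -tr_uvw.
  split=> //; have := leaves_ge2 e_sym e_irr e_conn acy T_gt1.
  have := subset_leq_card sub; rewrite -setUA cardsU1 cards2.
  case: (_ \notin _) (_ != _) => -[]; lia.
have [u [v [w sub]]] := card_le3_sub cardL.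
apply/eqP; rewrite eqn_leq triameter_le //=.
apply: leq_trans (perimeter_le_triameter e u v w).
exact: perimeter_ge.
Qed.
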